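(* Let $\Gamma$ be a connected non-bipartite biregular graph such that the two parts of its valency partition have equal size, and the induced subgraph on one of the parts is empty (has no edges). Then $\Gamma$ has exactly three distinct $\mathcal{L}$-eigenvalues if and only if it is obtained from the incidence graph of a projective plane by making any two distinct vertices corresponding to lines adjacent. Moreover, if the projective plane has line size $k$ and $v=k^2-k+1$ points, then the non-trivial (i.e. non-zero) $\mathcal{L}$-eigenvalues of $\Gamma$ are $\frac{v}{k^2}$ and $1+\frac{1}{k}$.
   Context: All graphs are finite, simple and undirected. $d_u$ denotes the valency (degree) of vertex $u$. The normalized Laplacian of a graph is the matrix $\mathcal{L}=[\ell_{uv}]$ indexed by the vertices with $\ell_{uu}=1$ if $d_u\neq 0$, $\ell_{uv}=-1/\sqrt{d_ud_v}$ if $u$ and $v$ are adjacent, and $\ell_{uv}=0$ otherwise. Its eigenvalues are called the $\mathcal{L}$-eigenvalues of the graph. A graph is biregular if exactly two distinct valencies occur. The valency partition is the partition of the vertex set according to valencies. A projective plane with line size $k$ means here a symmetric $2$-$(k^2-k+1,k,1)$ design with $k\ge 2$ (so the degenerate case $k=2$, the triangle, is included): there are $v=k^2-k+1$ points and $v$ lines, every line has $k$ points, every point is on $k$ lines, and any two distinct points are on exactly one common line. Its incidence graph is the bipartite graph on points and lines, a point being adjacent to the lines containing it. *)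

(* Defs.v *)
From mathcomp Require Import all_boot all_order all_algebra.

Set Implicit Arguments.
Unset Strict Implicit.
Unset Printing Implicit Defensive.

Import GRing.Theory Num.Theory.

(* A finite simple undirected graph is a symmetric and irreflexive relation
   on a finType of vertices. *)

Definition valency (T : finType) (e : rel T) (u : T) : nat :=
  #|[set w | e u w]|.

Definition connected_graph (T : finType) (e : rel T) : Prop :=
  forall x y : T, connect e x y.

Definition bipartite (T : finType) (e : rel T) : Prop :=
  exists A : {set T}, forall x y : T, e x y -> (x \in A) != (y \in A).

Definition biregular (T : finType) (e : rel T) : Prop :=
  size (undup (codom (valency e))) = 2.

Definition valency_partition (T : finType) (e : rel T) : {set {set T}} :=
  preim_partition (valency e) [set: T].

Definition graph_iso (S T : finType) (g : rel S) (e : rel T) : Prop :=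
  exists2 f : S -> T, bijective f & forall x y : S, e (f x) (f y) = g x y.

Definition plane_size (k : nat) : nat := k ^ 2 - k + 1.

(* Repeated lines need not be excluded: since [1 < k], two lines with the same
   points would be two common lines of two distinct points. *)
Record projective_plane (P B : finType) (inc : P -> B -> bool) (k : nat)
    : Prop := ProjectivePlane {
  pp_line_size_gt1 : 1 < k;
  pp_card_points : #|P| = plane_size k;
  pp_card_lines : #|B| = plane_size k;
  pp_line_size : forall b : B, #|[set p | inc p b]| = k;
  pp_point_valency : forall p : P, #|[set b | inc p b]| = k;
  pp_common_line : forall p q : P, p != q ->
    #|[set b | inc p b && inc q b]| = 1
}.

Definition incidence_graph (P B : finType) (inc : P -> B -> bool) :
    rel (P + B)%type :=
  fun x y => match x, y with
             | inl p, inr b => inc p b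
             | inr b, inl p => inc p b
             | _, _ => false
             end.

Definition is_line (P B : finType) (x : (P + B)%type) : bool :=
  if x is inr _ then true else false.

Definition join_lines (P B : finType) (g : rel (P + B)%type) :
    rel (P + B)%type :=
  fun x y => g x y || [&& is_line x, is_line y & x != y].

Local Open Scope ring_scope.

(* Vertices are turned into matrix indices by the enumeration of [T]. *)
Definition normalized_laplacian (R : rcfType) (T : finType) (e : rel T) :
    'M[R]_#|T| :=
  \matrix_(i, j)
    let u := enum_val i in let v := enum_val j in
    if u == v then (valency e u != 0%N)%:R
    else if e u v then - (Num.sqrt ((valency e u)%:R * (valency e v)%:R))^-1
    else 0.

Definition Leigenvalue (R : rcfType) (T : finType) (e : rel T) : pred R :=
  eigenvalue (normalized_laplacian R e).
Arguments Leigenvalue R {T} e a.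

Definition has_exactly (R : eqType) (p : pred R) (n : nat) : Prop :=
  exists s : seq R, [/\ uniq s, size s = n & forall a : R, p a = (a \in s)].

(* Main.v *)
(* The three eigenvalues of L are 0, t1, t2 with 0 simple, so (L - t1)(L - t2)
   is a multiple of w w^T with w_u = sqrt d_u. Entrywise this reads
     sum_(z ~ u, v) 1 / d_z - a [u ~ v] + b d_u [u = v] = c d_u d_v,
   with no square roots left. Let N be the bipartite adjacency matrix between
   the empty part (valency d1) and the other part (valency d2), which are both
   of size n. The diagonal entries and a double count show that N has all line
   sums d1 and that c d2^2 = 1; the entries inside the empty part give
   N N^T = (d1 - l) I + l J with l = d1^2 / d2 < d1, so N is invertible. The
   entries between the two parts become N (C - a d2 I - J) = 0, where C is the
   adjacency matrix of the second part; hence C = J - I, and counting gives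
   l = 1 and n = d1^2 - d1 + 1.
   Conversely, for a plane the eigenvalue equation of the random walk matrix is
   solved directly, using that its incidence matrix is invertible. *)
Require Import Defs.
From mathcomp Require Import all_boot all_order all_algebra.
From mathcomp Require Import spectral complex ring lra zify.

Import Order.TTheory GRing.Theory Num.Theory.
Local Open Scope ring_scope.

(** * Diagonalization of symmetric matrices and the maximum principle *)

(** Over the complex extension [S] is Hermitian, hence diagonalizable by an invertible matrix with
    real diagonal entries. These entries are eigenvalues of [S] itself and so roots of [q];
    diagonalizability is why each eigenvalue need occur only once in [s]. *)
Lemma symmetric_annihilated (R : rcfType) (n : nat) (S : 'M[R]_n)
    (s : seq R) :
  S^T = S -> (forall a, eigenvalue S a -> a \in s) ->
  \prod_(a <- s) (S - a%:M) = 0.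
Proof.
case: n S => [|n] S S_sym S_s; first by rewrite [LHS]flatmx0 [RHS]flatmx0.
pose q := \prod_(a <- s) ('X - a%:P).
have -> : \prod_(a <- s) (S - a%:M) = horner_mx S q.
  rewrite rmorph_prod; apply: eq_bigr => a _.
  by rewrite rmorphB /= horner_mx_X horner_mx_C.
pose A : 'M[complex R]_n.+1 := map_mx (real_complex R) S.
have A_real : A \is a mxOver Num.real.
  by apply/mxOverP=> i j; rewrite mxE; apply/complex_realP; exists (S i j).
have A_herm : A \is hermsymmx.
  apply: realsym_hermsym A_real; apply/is_hermitianmxP.
  rewrite expr0 scale1r map_mx_id //.
  by apply/matrixP=> i j; rewrite !mxE -[in RHS]S_sym mxE.
have /orthomx_spectralP := hermitian_normalmx A_herm.
have := hermitian_spectral_diag_real A_herm.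
have := spectral_unit A.
set P := spectralmx A; set D := spectral_diag A => P_unit D_real A_def.
have D_root i : (map_poly (real_complex R) q).[D 0 i] = 0.
  have /complex_realP[r Dr] : D 0 i \is Num.real by apply/mxOverP.
  have /S_s r_s : eigenvalue S r.
    suff : eigenvalue A (D 0 i).
      by rewrite Dr -[eigenvalue S r](eigenvalue_map (real_complex R)).
    (* The rows of [P] are left eigenvectors of [A]; none vanishes because [P] is invertible. *)
    apply/eigenvalueP; exists (row i P); last first.
      apply/eqP; rewrite rowE => Pi0.
      have: delta_mx 0 i = 0 :> 'rV[complex R]_n.+1.
        by rewrite -(mulmxK P_unit (delta_mx 0 i)) Pi0 mul0mx.
      by move/matrixP/(_ 0 i)/eqP; rewrite !mxE !eqxx oner_eq0.
    rewrite -row_mul A_def !mulmxA mulmxV // mul1mx.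
    by rewrite row_mul row_diag_mx -scalemxAl -rowE.
  rewrite Dr horner_map; have : root q r by rewrite root_prod_XsubC.
  by move=> /rootP ->; rewrite rmorph0.
apply: (@map_mx_inj _ _ (real_complex R : {rmorphism R -> complex R})).
rewrite map_mx0 map_horner_mx -/A A_def horner_mx_uconjC //.
rewrite horner_mx_diag [map_mx _ _](_ : _ = 0); last first.
  by apply/matrixP=> i j; rewrite !mxE ord1 D_root.
rewrite [diag_mx _](_ : _ = 0) ?mulmx0 ?mul0mx //.
by apply/matrixP=> i j; rewrite !mxE mul0rn.
Qed.

(** Maximum principle: at a maximum [m] of [z] the differences [z m - z v] over the neighbours are
    nonnegative with sum 0, so the maximum spreads along paths. This is the simplicity of the
    eigenvalue 0. *)
Lemma harmonic_constant (R : realDomainType) (T : finType) (e : rel T)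
    (z : T -> R) :
  connected_graph e ->
  (forall u, \sum_(v | e u v) z v = (valency e u)%:R * z u) ->
  forall u v, z u = z v.
Proof.
move=> e_conn z_harm u v.
have [m m_max] : exists m, forall x, z x <= z m.
  exists ([arg max_(i > u) z i]%O); case: Order.TotalTheory.arg_maxP => // m _.
  by move=> m_max x; apply: m_max.
suff z_eq x : z x = z m by rewrite !z_eq.
have /connectP[p] := e_conn m x.
elim/last_ind: p x => [|p y IHp] x; first by move=> _ /= ->.
rewrite rcons_path last_rcons => /andP[/IHp/(_ erefl) zp e_y ->].
set w := last m p in zp e_y.
have : \sum_(v | e w v) (z m - z v) = 0.
  rewrite sumrB z_harm zp sumr_const /valency cardsE mulr_natl.
  exact: subrr.
move/eqP; rewrite psumr_eq0 => [/allP/(_ y)|k _]; last by rewrite subr_ge0.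
by rewrite mem_index_enum e_y subr_eq0 => /(_ isT)/eqP.
Qed.

(** * The normalized Laplacian as a random walk operator *)

Section NormalizedAdjacency.

Variables (R : rcfType) (T : finType) (e : rel T).
Hypotheses (e_sym : symmetric e) (e_irr : irreflexive e).
Hypothesis valency_neq0 : forall u, valency e u != 0%N.

Let d (u : T) : R := (valency e u)%:R.
Let rt (u : T) : R := Num.sqrt (d u).

Let M : 'M[R]_#|T| :=
  \matrix_(i, j) ((e (enum_val i) (enum_val j))%:R /
                    (rt (enum_val i) * rt (enum_val j))).

Let rt_neq0 u : rt u != 0.
Proof. by rewrite gt_eqF // sqrtr_gt0 ltr0n lt0n. Qed.

Let rt_sqr u : rt u * rt u = d u.
Proof. by rewrite -expr2 sqr_sqrtr ?ler0n. Qed.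

Let laplacianE : normalized_laplacian R e = 1%:M - M.
Proof.
apply/matrixP=> i j; rewrite !mxE /= (inj_eq enum_val_inj).
case: eqVneq => [->|_]; first by rewrite e_irr valency_neq0 mul0r subr0.
rewrite mulr0n sub0r sqrtrM ?ler0n //.
by case: (e _ _); rewrite ?mul1r ?mul0r ?oppr0.
Qed.

Let M_tr : M^T = M.
Proof. by apply/matrixP=> i j; rewrite !mxE e_sym [rt _ * _]mulrC. Qed.

Let row_mulM (v : 'rV_#|T|) (u : T) :
  rt u * (v *m M) 0 (enum_rank u) =
  \sum_(w | e u w) v 0 (enum_rank w) / rt w.
Proof.
rewrite mxE mulr_sumr (reindex enum_rank) /=; last exact/onW_bij/enum_rank_bij.
rewrite [RHS]big_mkcond; apply: eq_bigr => w _.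
rewrite !mxE !enum_rankK e_sym; case: (e u w); last by rewrite mul0r !mulr0.
by rewrite mul1r; field; rewrite !rt_neq0.
Qed.

(* The substitution v_u = sqrt d_u * z_u turns eigenvectors of L into
   eigenfunctions of the random walk. *)
Lemma LeigenvalueP (a : R) :
  Leigenvalue R e a <->
  exists2 z : T -> R, exists u, z u != 0 &
    forall u, \sum_(v | e u v) z v = (1 - a) * d u * z u.
Proof.
rewrite /Leigenvalue laplacianE; split=> [/eigenvalueP[v v_eig v_neq0]|].
  exists (fun u => v 0 (enum_rank u) / rt u).
    have [/forallP v0|/forallPn[u u_neq0]] :=
      boolP [forall u, v 0 (enum_rank u) == 0].
      case/eqP: v_neq0; apply/matrixP=> i j; rewrite ord1 mxE.
      by rewrite -(eqP (v0 (enum_val j))) enum_valK.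
    by exists u; rewrite mulf_neq0 // invr_neq0.
  move=> u; rewrite -row_mulM.
  have -> : v *m M = (1 - a) *: v.
    by rewrite scalerBl scale1r -v_eig mulmxBr mulmx1 opprB addrC subrK.
  by rewrite mxE -rt_sqr; field; rewrite rt_neq0.
case=> z [u zu_neq0] z_eig; apply/eigenvalueP.
pose v : 'rV[R]_#|T| := \row_i (rt (enum_val i) * z (enum_val i)).
exists v; last first.
  apply: contraNneq zu_neq0 => /matrixP/(_ 0 (enum_rank u)).
  by rewrite !mxE enum_rankK => /eqP; rewrite mulf_eq0 (negPf (rt_neq0 u)).
have vM : v *m M = (1 - a) *: v.
  apply/matrixP=> i j; rewrite ord1 -[j]enum_valK.
  apply: (mulfI (rt_neq0 (enum_val j))); rewrite row_mulM.
  transitivity (\sum_(w | e (enum_val j) w) z w).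
    by apply: eq_bigr => w _; rewrite mxE enum_rankK; field; rewrite rt_neq0.
  by rewrite z_eig !mxE enum_valK -rt_sqr; ring.
by rewrite mulmxBr mulmx1 vM scalerBl scale1r opprB addrC subrK.
Qed.

Lemma three_Leigenvalues_walks :
  connected_graph e -> has_exactly (Leigenvalue R e) 3 ->
  exists a b c : R, forall u v,
    \sum_z (e u z)%:R * (e v z)%:R / d z - a * (e u v)%:R
      + b * d u * (u == v)%:R = c * d u * d v.
Proof.
move=> e_conn [s [s_uniq s_size s_eig]].
have [u0|T0] := pickP T; last by exists 0, 0, 0 => u; have := T0 u.
move=> _.
(* Constant functions are fixed by the random walk, so 0 is one of the three eigenvalues. *)
have s0 : 0 \in s.
  rewrite -s_eig; apply/LeigenvalueP; exists (fun=> 1).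
    by exists u0; rewrite oner_neq0.
  by move=> u; rewrite subr0 mul1r mulr1 sumr_const /d /valency cardsE.
have [i s' rot_s] := rot_to s0.
have : size s' = 2.
  by have := congr1 size rot_s; rewrite size_rot s_size => -[].
case: s' rot_s => [|a [|b []]] // rot_s _.
pose L := normalized_laplacian R e.
have L_tr : L^T = L by rewrite /L laplacianE linearB /= trmx1 M_tr.
(* Each row of K lies in the kernel of L, which is spanned by rt; as K is
   symmetric, it is a multiple of the matrix rt u * rt v. *)
pose K := (L - b%:M) *m (L - a%:M).
have K_def : K = M *m M - (2 - a - b) *: M + ((1 - a) * (1 - b))%:M.
  have L_sub x : L - x%:M = (1 - x)%:M - M.
    by rewrite /L laplacianE raddfB /= addrAC.
  rewrite /K !L_sub mulmxBl !mulmxBr -scalar_mxM mul_scalar_mx mul_mx_scalar.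
  apply/matrixP=> k l; move: (M *m M) => MM; rewrite !mxE.
  by case: eqP => _; rewrite ?mulr1n ?mulr0n; ring.
have K_tr : K^T = K.
  by rewrite K_def linearD linearB linearZ /= trmx_mul M_tr tr_scalar_mx.
(* The factors are ordered [b], [a], 0 so that [K] is the initial part of the annihilating
   product. *)
have KL0 : K *m L = 0.
  have /(_ _)/= := @symmetric_annihilated R _ L [:: b; a; 0] L_tr.
  rewrite !big_cons big_nil mulr1 raddf0 subr0 mulrA; apply=> x.
  rewrite -[eigenvalue L x]/(Leigenvalue R e x) s_eig -(mem_rot i) rot_s !inE.
  by case/or3P=> ->; rewrite ?orbT.
have K_row j u : K j (enum_rank u) / rt u = K j (enum_rank u0) / rt u0.
  pose z u := K j (enum_rank u) / rt u.
  apply: (@harmonic_constant R T e z e_conn _ u u0) => {}u.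
  have rowM : row j K *m M = row j K.
    have : row j K *m L = 0 by rewrite -row_mul KL0 row0.
    by rewrite /L laplacianE mulmxBr mulmx1 => /eqP; rewrite subr_eq0 => /eqP.
  transitivity (\sum_(w | e u w) row j K 0 (enum_rank w) / rt w).
    by apply: eq_bigr => w _; rewrite mxE.
  rewrite -row_mulM rowM mxE /z -[(valency e u)%:R]rt_sqr; field.
  exact: rt_neq0.
pose c := K (enum_rank u0) (enum_rank u0) / rt u0 / rt u0.
have K_c u v : K (enum_rank u) (enum_rank v) = c * rt u * rt v.
  apply: (mulIf (invr_neq0 (rt_neq0 v))); rewrite K_row.
  rewrite -[in LHS]K_tr mxE.
  apply: (mulIf (invr_neq0 (rt_neq0 u))); rewrite mulrAC K_row.
  by rewrite /c; field; rewrite !rt_neq0.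
(* Here [a] and [b] are the nonzero eigenvalues. The coefficients are those of [K_def], and
   multiplying by [rt u * rt v] clears the square roots. *)
exists (2 - a - b), ((1 - a) * (1 - b)), c => u v.
have := K_c u v; rewrite K_def => /(congr1 (fun x => x * (rt u * rt v))).
rewrite [c * _ * _ * _](_ : _ = c * d u * d v); last by rewrite -!rt_sqr; ring.
move=> <-.
have -> : \sum_z (e u z)%:R * (e v z)%:R / d z =
    rt u * (M *m M) (enum_rank u) (enum_rank v) * rt v.
  rewrite mxE (reindex enum_rank) /=; last exact/onW_bij/enum_rank_bij.
  rewrite mulr_sumr mulr_suml; apply: eq_bigr => w _.
  rewrite !mxE !enum_rankK (e_sym w v) -rt_sqr.
  by field; rewrite !rt_neq0.
have -> : (e u v)%:R = rt u * M (enum_rank u) (enum_rank v) * rt v.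
  by rewrite mxE !enum_rankK; field; rewrite !rt_neq0.
rewrite -[(1 - a) * (1 - b) * _ * _]mulrA.
have -> : d u * (u == v)%:R = rt u * (u == v)%:R * rt v.
  by case: eqP => [<-|_]; rewrite ?mulr1 ?mulr0 ?mul0r ?rt_sqr.
move: (M *m M) => MM; rewrite !mxE !enum_rankK (inj_eq enum_rank_inj).
by rewrite -[_ *+ _]mulr_natr; ring.
Qed.

End NormalizedAdjacency.

(** * Invertibility from a Gram matrix, and recognition of a plane *)

(** The Gram matrix [(r - l) I + l J] is nonsingular, so the block of [N] on [A] and [B] has
    independent rows. Equal cardinalities make the block square, hence its columns are independent
    too. *)
Lemma gram_injective (R : realFieldType) (T S : finType) (A : {set T})
    (B : {set S}) (N : T -> S -> R) (r l : R) (y : S -> R) :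
  #|A| = #|B| -> 0 <= l -> l < r ->
  {in A &, forall p q,
     \sum_(b in B) N p b * N q b = if p == q then r else l} ->
  {in A, forall p, \sum_(b in B) N p b * y b = 0} ->
  {in B, forall b, y b = 0}.
Proof.
move=> cardAB l_ge0 l_lt_r gramN Ny0.
pose M : 'M_(#|A|, #|B|) := \matrix_(i, j) N (enum_val i) (enum_val j).
have gramM i j : (M *m M^T) i j = (r - l) *+ (i == j) + l.
  rewrite mxE -[i == j](inj_eq enum_val_inj).
  transitivity (\sum_(b in B) N (enum_val i) b * N (enum_val j) b).
    by rewrite [RHS]big_enum_val; apply: eq_bigr => k _; rewrite !mxE.
  rewrite gramN ?enum_valP //.
  by case: eqP => _; rewrite ?mulr1n ?mulr0n ?add0r // subrK.
have M_free : row_free M.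
  apply: inj_row_free => v vM0; pose s := \sum_i v 0 i.
  have v_eq j : (r - l) * v 0 j + l * s = 0.
    have /matrixP/(_ 0 j) : v *m (M *m M^T) = 0 by rewrite mulmxA vM0 mul0mx.
    rewrite [X in X = _]mxE [X in _ = X]mxE => <-.
    under eq_bigr do rewrite gramM mulrDr.
    rewrite big_split /= -mulr_suml mulrC [l * s]mulrC; congr (_ + _).
    rewrite (bigD1 j) //= eqxx mulr1n big1 ?addr0 // => k /negPf->.
    by rewrite mulr0n mulr0.
  have s0 : s = 0.
    (* Summing [v_eq] over all coordinates gives an equation for [s] alone, with positive
       coefficient. *)
    have : (r - l + l * #|A|%:R) * s = 0.
      transitivity (\sum_j ((r - l) * v 0 j + l * s)); last exact: big1.
      rewrite big_split /= -mulr_sumr -/s sumr_const card_ord.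
      by rewrite mulrDl -mulrnAr -mulrA mulr_natl.
    move/eqP; rewrite mulf_eq0 => /orP[|/eqP //].
    by rewrite gt_eqF // ltr_wpDr ?subr_gt0 // mulr_ge0.
  apply/matrixP=> i j; rewrite ord1 mxE.
  have /eqP := v_eq j; rewrite s0 mulr0 addr0 mulf_eq0 subr_eq0 gt_eqF //=.
  by move/eqP.
have /row_fullP[D DM] : row_full M.
  by rewrite /row_full (eqP M_free) cardAB.
pose Y : 'cV_#|B| := \col_j y (enum_val j).
have MY0 : M *m Y = 0.
  apply/matrixP=> i k; rewrite mxE mxE.
  rewrite -[RHS](Ny0 (enum_val i)) ?enum_valP // [RHS]big_enum_val.
  by apply: eq_bigr => j _; rewrite !mxE.
move=> b bB; have /matrixP/(_ (enum_rank_in bB b) 0) : Y = 0.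
  by rewrite -[Y]mul1mx -DM -mulmxA MY0 mulmx0.
by rewrite !mxE enum_rankK_in.
Qed.

Lemma natr_card (R : pzSemiRingType) (T : finType) (B : {pred T})
    (P : pred T) :
  \sum_(x in B) (P x)%:R = #|[set x in B | P x]|%:R :> R.
Proof.
rewrite -sum1_card natr_sum big_mkcond [RHS]big_mkcond; apply: eq_bigr => x _.
by rewrite inE; case: (x \in B); case: (P x).
Qed.

(** Points are the vertices of [A], lines those of its complement, and incidence is adjacency. Since
    [A] is independent and its complement a clique, the incidence determines all of [e]. *)
Lemma plane_of_parts (T : finType) (e : rel T) (A : {set T}) (k : nat) :
  symmetric e -> irreflexive e -> (1 < k)%N ->
  #|A| = plane_size k -> #|~: A| = plane_size k ->
  {in A &, forall x y, ~~ e x y} ->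
  {in ~: A &, forall x y, x != y -> e x y} ->
  {in A, forall p, #|[set u in ~: A | e p u]| = k} ->
  {in ~: A, forall u, #|[set p in A | e p u]| = k} ->
  {in A &, forall p q, p != q -> #|[set u in ~: A | e p u && e q u]| = 1%N} ->
  exists (P B : finType) (inc : P -> B -> bool),
    projective_plane inc k /\ graph_iso (join_lines (incidence_graph inc)) e.
Proof.
move=> e_sym e_irr k_gt1 cardA cardC A_empty C_complete degA degC common.
pose P : finType := {p | p \in A}; pose B : finType := {u | u \in ~: A}.
pose inc (p : P) (b : B) := e (val p) (val b).
have card_val (D : {set T}) (Q : pred T) :
    #|[set x : {x | x \in D} | Q (val x)]| = #|[set x in D | Q x]|.
  rewrite -(card_imset _ val_inj); apply: eq_card => u; rewrite inE.
  apply/imsetP/andP=> [[x + ->]|[uD Qu]].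
    by rewrite inE; split=> //; apply: valP.
  by exists (Sub u uD); rewrite ?inE SubK.
exists P, B, inc; split.
  split=> //; first by rewrite card_sig.
  - by rewrite card_sig.
  - move=> b; rewrite (card_val A (fun p => e p (val b))).
    exact: degC (valP b).
  - move=> p; rewrite (card_val (~: A) (e (val p))).
    exact: degA (valP p).
  - move=> p q pq; rewrite (card_val _ (fun u => e (val p) u && e (val q) u)).
    exact: common (valP p) (valP q) _.
pose f (x : (P + B)%type) : T :=
  match x with inl p => val p | inr b => val b end.
exists f.
  have f_inj : injective f.
    move=> [p|b] [q|b'] /= => [/val_inj->|E|E|/val_inj->] //.
      by have := valP b'; rewrite inE /= -E (valP p).
    by have := valP b; rewrite inE /= E (valP q).
  apply: inj_card_bij f_inj _.
  by rewrite card_sum !card_sig -(cardsC A).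
case=> [p|b] [q|b']; rewrite /join_lines /= ?andbF ?orbF //.
  by apply/negbTE/A_empty; apply: valP.
case: eqVneq => [[->]|bb']; first exact: e_irr.
exact: C_complete (valP b) (valP b') _.
Qed.

(** * From the walk equations to a projective plane *)

Section EmptyPart.

Variables (R : realFieldType) (T : finType) (e : rel T) (A : {set T}).
Variables (d1 d2 : nat) (a b c : R).
Hypotheses (e_sym : symmetric e) (e_irr : irreflexive e).
Hypotheses (d1_gt0 : (0 < d1)%N) (d2_gt0 : (0 < d2)%N) (d1_neq_d2 : d1 != d2).
Hypothesis valency_in : forall u, u \in A -> valency e u = d1.
Hypothesis valency_out : forall u, u \notin A -> valency e u = d2.
Hypothesis card_parts : #|A| = #|~: A|.
Hypothesis A_empty : forall x y, x \in A -> y \in A -> e x y = false.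
Hypothesis e_nbip : ~ bipartite e.
Hypothesis walks : forall u v,
  \sum_z (e u z)%:R * (e v z)%:R / (valency e z)%:R - a * (e u v)%:R
    + b * (valency e u)%:R * (u == v)%:R
    = c * (valency e u)%:R * (valency e v)%:R.

Let D1 : R := d1%:R.
Let D2 : R := d2%:R.
Let N u v : R := (e u v)%:R.
Let n : R := #|A|%:R.

Let D1_neq0 : D1 != 0. Proof. by rewrite pnatr_eq0 -lt0n. Qed.
Let D2_neq0 : D2 != 0. Proof. by rewrite pnatr_eq0 -lt0n. Qed.
Let D12 : D1 != D2. Proof. by rewrite eqr_nat. Qed.

Let NC u v : N u v = N v u. Proof. by rewrite /N e_sym. Qed.
Let NN u v : N u v * N u v = N u v.
Proof. by rewrite /N; case: (e u v); rewrite ?mulr1 ?mulr0. Qed.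

Let Nxx u : N u u = 0. Proof. by rewrite /N e_irr. Qed.

Let walks_split u v :
  (\sum_(z in A) N u z * N v z) / D1 + (\sum_(z in ~: A) N u z * N v z) / D2
    - a * N u v + b * (valency e u)%:R * (u == v)%:R
    = c * (valency e u)%:R * (valency e v)%:R.
Proof.
rewrite -walks; congr (_ - _ + _).
rewrite [RHS](bigID (mem A)) /= !mulr_suml; congr (_ + _).
  by apply: eq_bigr => z zA; rewrite valency_in.
apply: eq_big => z; first by rewrite inE.
by rewrite inE => zA; rewrite valency_out.
Qed.

Let sum_A_in (p : T) (F : T -> R) : p \in A -> \sum_(z in A) N p z * F z = 0.
Proof. by move=> pA; apply: big1 => z zA; rewrite /N A_empty ?mul0r. Qed.

Let sum_N (u : T) :
  \sum_(z in A) N u z + \sum_(z in ~: A) N u z = (valency e u)%:R.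
Proof.
rewrite /N !natr_card -natrD /valency -(cardsID A [set w | e u w]).
by congr ((_ + _)%:R); apply: eq_card => z; rewrite !inE andbC.
Qed.

Let deg_in p : p \in A -> \sum_(z in ~: A) N p z = D1.
Proof.
move=> pA; rewrite -[D1]/(d1%:R) -(valency_in _ pA) -sum_N.
by rewrite [X in _ = X + _]big1 ?add0r // => z zA; rewrite /N A_empty.
Qed.

(** Otherwise [A] and its complement would form a bipartition. *)
Let edge_out : exists z u, [/\ z \notin A, u \notin A & e z u].
Proof.
have [/existsP[z /existsP[u /and3P[]]]|none] :=
  boolP [exists z, exists u, [&& z \notin A, u \notin A & e z u]].
  by exists z, u.
case: e_nbip; exists A => x y exy.
have [xA|xA] := boolP (x \in A); have [yA|yA] //= := boolP (y \in A).
  by rewrite A_empty in exy.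
by case/existsP: none; exists x; apply/existsP; exists y; rewrite xA yA.
Qed.

Let pair_in : exists p q, [/\ p \in A, q \in A & p != q].
Proof.
suff /card_gt1P[p [q [pA qA pq]]] : (1 < #|A|)%N by exists p, q.
have [z [u [zA uA ezu]]] := edge_out; rewrite card_parts.
apply/card_gt1P; exists z, u; rewrite !inE zA uA; split=> //.
by apply: contraTneq ezu => ->; rewrite e_irr.
Qed.

Let n_neq0 : n != 0.
Proof.
have [p [_ [pA _ _]]] := pair_in.
by rewrite pnatr_eq0 -lt0n; apply/card_gt0P; exists p.
Qed.

(** The diagonal entry at [v] outside [A] is linear in the number [x v] of neighbours in [A], with
    nonzero slope [D1^-1 - D2^-1], so [x] is constant. Counting the cross edges from [A] gives total
    [n * D1], and the parts have equal size. *)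
Let deg_cross u : u \in ~: A -> \sum_(p in A) N u p = D1.
Proof.
pose x u := \sum_(p in A) N u p; pose K := c * D2 ^+ 2 - b * D2 - 1.
have x_eq v : v \in ~: A -> x v * (D1^-1 - D2^-1) = K.
  move=> vA; have := walks_split v v; have := sum_N v.
  rewrite inE in vA.
  rewrite eqxx valency_out // -/D2 Nxx => sumN.
  under eq_bigr do rewrite NN.
  under [\sum_(z in ~: A) N v z * N v z]eq_bigr do rewrite NN.
  rewrite -[\sum_(z in ~: A) N v z](addKr (x v)) sumN /= -/(x v).
  move=> E; rewrite /K; transitivity (c * D2 * D2 - b * D2 - 1); last by ring.
  by rewrite -E; field; rewrite D1_neq0 D2_neq0.
have D_neq0 : D1^-1 - D2^-1 != 0.
  by rewrite subr_eq0 (inj_eq invr_inj).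
have : \sum_(v in ~: A) x v = n * D1.
  rewrite exchange_big /= [n * D1]mulr_natl -sumr_const; apply: eq_bigr => p pA.
  by rewrite -(deg_in _ pA); apply: eq_bigr => v _; rewrite NC.
move=> /(congr1 (fun s => s * (D1^-1 - D2^-1))).
rewrite mulr_suml; under eq_bigr do rewrite x_eq //.
rewrite sumr_const -card_parts -[K *+ _]mulr_natl -mulrA.
move=> /(mulfI n_neq0) K_eq uA.
by apply: (mulIf D_neq0); rewrite [LHS]x_eq.
Qed.

(** The diagonal entries on the two parts are two linear equations in [b] and [c]. Eliminating [b]
    leaves the claim times the nonzero factor [D2 - D1]. *)
Let c_eq : c * D2 ^+ 2 = 1.
Proof.
have [p [_ [pA _ _]]] := pair_in; have [u [_ [uA _ _]]] := edge_out.
have uA' : u \in ~: A by rewrite inE.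
have := walks_split p p; rewrite sum_A_in // eqxx mulr1 valency_in // -/D1.
under eq_bigr do rewrite NN.
rewrite deg_in // Nxx => Ep.
have := sum_N u; have := walks_split u u.
under eq_bigr do rewrite NN.
under [\sum_(z in ~: A) N u z * N u z]eq_bigr do rewrite NN.
rewrite deg_cross // eqxx mulr1 valency_out // Nxx -/D2 => Eu Su.
have b_eq : b = c * D1 - D2^-1.
  apply: (mulIf D1_neq0); transitivity (c * D1 * D1 - D1 / D2); last by ring.
  by rewrite -Ep; field; rewrite D2_neq0.
have S_eq : \sum_(z in ~: A) N u z = D2 - D1 by rewrite -Su addrC addKr.
rewrite S_eq b_eq in Eu.
have D21 : D2 - D1 != 0 by rewrite subr_eq0 eq_sym.
apply: (mulIf D21); rewrite mul1r.
transitivity ((c * D2 * D2) * D2 - c * D1 * D2 ^+ 2); first by ring.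
by rewrite -Eu; field; rewrite D1_neq0 D2_neq0.
Qed.

(** The number of common neighbours of two distinct vertices of [A], read off from the walk
    equation. *)
Let l : R := c * D1 ^+ 2 * D2.

Let l_eq : l * D2 = D1 ^+ 2.
Proof. by rewrite -[RHS]mul1r -c_eq /l; ring. Qed.

Let gram_in : {in A &, forall p q,
  \sum_(z in ~: A) N p z * N q z = if p == q then D1 else l}.
Proof.
move=> p q pA qA; case: eqVneq => [<-|pq].
  by under eq_bigr do rewrite NN; exact: deg_in.
have := walks_split p q.
rewrite sum_A_in // (negPf pq) mulr0 !valency_in // -/D1.
have -> : N p q = 0 by rewrite /N A_empty.
move=> E.
rewrite /l; transitivity (c * D1 * D1 * D2); last by ring.
by rewrite -E; field; rewrite D1_neq0 D2_neq0.
Qed.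

(** Common neighbours of [p] and [q] are among the [D1] neighbours of [p]; equality would turn
    [l_eq] into [D1 = D2]. *)
Let l_lt : l < D1.
Proof.
have [p [q [pA qA pq]]] := pair_in; rewrite lt_neqAle; apply/andP; split.
  apply: contra_neq D12 => l_D1; apply: (mulfI D1_neq0).
  by rewrite -expr2 -l_eq l_D1.
have := gram_in _ _ pA qA; rewrite (negPf pq) => <-.
rewrite -(deg_in _ pA); apply: ler_sum => z _.
by rewrite /N; case: (e p z); case: (e q z); rewrite ?mulr1 ?mulr0 ?ler01.
Qed.

Let l_ge0 : 0 <= l.
Proof.
have [p [q [pA qA pq]]] := pair_in.
have := gram_in _ _ pA qA; rewrite (negPf pq) => <-.
by apply: sumr_ge0 => z _; rewrite mulr_ge0 ?ler0n.
Qed.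

Let nonempty_part_complete z u : z \notin A -> u \notin A -> z != u -> e z u.
Proof.
move=> zA uA zu; have uA' : u \in ~: A by rewrite inE.
(* The column of [u] in [C - a D2 I - J], with [C] the adjacency matrix of the second part. The
   entries between the parts say that [N] annihilates it; its vanishing at [z] is the adjacency of
   [z] and [u]. *)
pose y w := N w u - a * D2 * (w == u)%:R - 1.
have Ny0 : {in A, forall p, \sum_(w in ~: A) N p w * y w = 0}.
  move=> p pA; have := walks_split p u.
  have pu : p == u = false by apply: contraNF uA => /eqP <-.
  rewrite sum_A_in // pu valency_in // valency_out // -/D1 -/D2 mul0r add0r.
  rewrite mulr0 addr0 => E.
  transitivity (\sum_(w in ~: A) N p w * N u w
     - a * D2 * (\sum_(w in ~: A) N p w * (w == u)%:R)
     - \sum_(w in ~: A) N p w).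
    rewrite mulr_sumr -!sumrB; apply: eq_bigr => w _.
    by rewrite /y [N w u]NC; ring.
  have -> : \sum_(w in ~: A) N p w * (w == u)%:R = N p u.
    rewrite (bigD1 u) //= eqxx mulr1 big1 ?addr0 // => w /andP[_ /negPf->].
    by rewrite mulr0.
  rewrite deg_in // -[D1 in LHS]mulr1 -c_eq.
  transitivity (D2 * (c * D1 * D2) - D1 * (c * D2 ^+ 2)); last by ring.
  by rewrite -E; field.
have := @gram_injective R T T A (~: A) N D1 l y card_parts l_ge0 l_lt gram_in
  Ny0.
move=> /(_ z); rewrite inE zA /y (negPf zu) mulr0 subr0 => /(_ isT)/eqP.
by rewrite subr_eq0 /N; case: (e z u) => //; rewrite eq_sym oner_eq0.
Qed.

Let D2_eq : D2 = D1 + n - 1.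
Proof.
have [u [_ [uA _ _]]] := edge_out; have uA' : u \in ~: A by rewrite inE.
have := sum_N u; rewrite deg_cross // valency_out // -/D2 => <-.
rewrite -addrA; congr (_ + _); rewrite /n card_parts -sum1_card natr_sum.
rewrite (bigD1 u) //= [RHS](_ : _ = \sum_(i in ~: A | i != u) 1); last first.
  by rewrite (bigD1 u) //= addrC addKr.
rewrite Nxx add0r; apply: eq_bigr => w /andP[]; rewrite inE => wA wu.
by rewrite /N nonempty_part_complete // eq_sym.
Qed.

(** Walks of length two from a fixed [p] in [A] back into [A], counted by end vertex [q] and by
    middle vertex [z]. *)
Let l_n : D1 + (n - 1) * l = D1 ^+ 2.
Proof.
have [p [_ [pA _ _]]] := pair_in.
transitivity (\sum_(q in A) \sum_(z in ~: A) N p z * N q z).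
  rewrite (bigD1 p) //= gram_in // eqxx; congr (_ + _).
  transitivity (\sum_(q in A | q != p) l); last first.
    by apply: eq_bigr => q /andP[qA /negPf qp]; rewrite gram_in // eq_sym qp.
  apply: (addrI l); rewrite -(bigD1 p) //= sumr_const -[RHS]mulr_natl -/n.
  by ring.
rewrite exchange_big /= expr2 -[X in _ = X * _](deg_in _ pA) mulr_suml.
apply: eq_bigr => z zA; rewrite -mulr_sumr; congr (_ * _).
by rewrite -(deg_cross _ zA); apply: eq_bigr => q _; rewrite NC.
Qed.

(** Multiplying [D2_eq] by [l] and substituting [l_eq] and [l_n] leaves [l * D1 = D1]. *)
Let l1 : l = 1.
Proof.
apply: (mulIf D1_neq0); transitivity (l * D2 - (n - 1) * l).
  by rewrite D2_eq; ring.
by rewrite l_eq -l_n; ring.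
Qed.

Let card_empty_part : #|A| = plane_size d1.
Proof.
have : n = D1 ^+ 2 - D1 + 1 by rewrite -l_n l1; ring.
(* Adding [d1] avoids the truncated subtraction of [plane_size] on the way back to natural
   numbers. *)
move=> n_eq; have : (#|A| + d1)%:R = (d1 ^ 2 + 1)%:R :> R.
  by rewrite !natrD natrX -/n -/D1 n_eq; ring.
move/eqP; rewrite eqr_nat => /eqP; rewrite /plane_size.
have : (d1 <= d1 ^ 2)%N by rewrite -mulnn leq_pmulr.
by lia.
Qed.

Let empty_part_common p q : p \in A -> q \in A -> p != q ->
  #|[set z in ~: A | e p z && e q z]| = 1.
Proof.
move=> pA qA pq; have := gram_in _ _ pA qA; rewrite (negPf pq) l1 => gram1.
apply/eqP; rewrite -(eqr_nat R) -natr_card -[X in _ == X]gram1; apply/eqP.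
by apply: eq_bigr => z _; rewrite /N -natrM mulnb.
Qed.

Let card_cross_in p : p \in A -> #|[set z in ~: A | e p z]| = d1.
Proof.
move=> pA; apply/eqP.
by rewrite -(eqr_nat R) -natr_card [X in X == _]deg_in.
Qed.

Let card_cross_out u : u \notin A -> #|[set p in A | e p u]| = d1.
Proof.
move=> uA; apply/eqP; rewrite -(eqr_nat R) -natr_card -/D1.
rewrite -(@deg_cross u) ?inE //.
by apply/eqP/eq_bigr => p _; exact: NC.
Qed.

(** With [d1 = 1] the size formula would leave a single vertex in [A]. *)
Let valency_empty_part_gt1 : (1 < d1)%N.
Proof.
have [p [q [pA qA pq]]] := pair_in.
have : (1 < #|A|)%N by apply/card_gt1P; exists p, q.
rewrite card_empty_part /plane_size; case: d1 d1_gt0 => [|[|]] //.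
Qed.

Lemma plane_of_walks :
  exists (P B : finType) (inc : P -> B -> bool),
    projective_plane inc d1 /\ graph_iso (join_lines (incidence_graph inc)) e.
Proof.
apply: (plane_of_parts T e A) => //.
- by rewrite -card_parts card_empty_part.
- by move=> x y xA yA; rewrite A_empty.
- by move=> z u; rewrite !inE; exact: nonempty_part_complete.
- by move=> u; rewrite inE; exact: card_cross_out.
Qed.

End EmptyPart.

(** * Invariance of the spectrum under isomorphism *)

(** The two matrices are indexed by unrelated enumerations, so eigenfunctions in the sense of
    [LeigenvalueP] are transported instead. *)
Lemma Leigenvalue_iso (R : rcfType) (S T : finType) (g : rel S) (e : rel T)
    (a : R) :
  symmetric e -> irreflexive e -> (forall u, valency e u != 0%N) ->
  graph_iso g e -> Leigenvalue R g a <-> Leigenvalue R e a.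
Proof.
move=> e_sym e_irr e_val [f [h fK hK] fE].
have valE x : valency e (f x) = valency g x.
  rewrite /valency -(card_imset _ (can_inj fK)); apply: eq_card => y.
  rewrite inE.
  apply/idP/imsetP=> [efy|[z + ->]]; last by rewrite inE fE.
  by exists (h y); rewrite ?hK // inE -fE hK.
have g_sym : symmetric g by move=> x y; rewrite -!fE e_sym.
have g_irr : irreflexive g by move=> x; rewrite -fE e_irr.
have g_val x : valency g x != 0%N by rewrite -valE.
have sumE (z : T -> R) x :
    \sum_(v | e (f x) v) z v = \sum_(w | g x w) z (f w).
  rewrite (reindex f) /=; last by apply: onW_bij; exists h.
  by apply: eq_bigl => w; rewrite fE.
rewrite (LeigenvalueP _ _ _ g_sym) // (LeigenvalueP _ _ _ e_sym) //.
split=> -[z [u zu] z_eig].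
  exists (z \o h); first by exists (f u); rewrite /= fK.
  move=> v; rewrite -[v]hK sumE /= fK valE -z_eig.
  by apply: eq_bigr => w _; rewrite fK.
exists (z \o f); first by exists (h u); rewrite /= hK.
by move=> x; rewrite /= -sumE z_eig valE.
Qed.

(** * The spectrum of the graph of a projective plane *)

Section PlaneGraph.

Variables (P B : finType) (inc : P -> B -> bool) (k : nat).
Hypothesis plane : projective_plane inc k.

Let g := join_lines (incidence_graph inc).

Let k_gt1 : (1 < k)%N := pp_line_size_gt1 plane.

Lemma join_lines_sym : symmetric g.
Proof. by case=> [p|b] [q|b'] //; rewrite /g /join_lines /= eq_sym. Qed.

Lemma join_lines_irr : irreflexive g.
Proof. by case=> [p|b] //; rewrite /g /join_lines /= eqxx. Qed.

Let sum_point (V : nmodType) (F : (P + B)%type -> V) p :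
  \sum_(v | g (inl p) v) F v = \sum_(b | inc p b) F (inr b).
Proof.
rewrite big_sumType /= big_pred0 ?add0r //.
by apply: eq_bigl => b; rewrite /g /join_lines /= orbF.
Qed.

Let sum_line (V : nmodType) (F : (P + B)%type -> V) b :
  \sum_(v | g (inr b) v) F v =
  \sum_(p | inc p b) F (inl p) + \sum_(b' | b' != b) F (inr b').
Proof.
rewrite big_sumType /=; congr (_ + _); apply: eq_bigl => x.
  by rewrite /g /join_lines /= orbF.
by rewrite /g /join_lines /= eq_sym.
Qed.

Let valency_point p : valency g (inl p) = k.
Proof.
rewrite /valency cardsE -sum1_card; have := sum_point nat (fun=> 1%N) p.
by rewrite /= => ->; rewrite sum1dep_card (pp_point_valency plane).
Qed.

(** A line is adjacent to its [k] points and to the [k ^ 2 - k] other lines. *)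
Let valency_line b : valency g (inr b) = (k ^ 2)%N.
Proof.
rewrite /valency cardsE -sum1_card; have := sum_line nat (fun=> 1%N) b.
rewrite /= => ->; rewrite !sum1dep_card (pp_line_size plane).
have -> : #|[set b' | b' != b]| = #|[set~ b]|.
  by apply: eq_card => b'; rewrite !inE.
rewrite cardsC1 (pp_card_lines plane) /plane_size.
rewrite -[(k + _)%R]/(k + _)%N.
have : (k <= k ^ 2)%N by rewrite -mulnn leq_pmulr // ltnW.
by move: (k ^ 2)%N => m; lia.
Qed.

Variable R : rcfType.

Let K : R := k%:R.
Let V : R := (plane_size k)%:R.

Let V_eq : V = K ^+ 2 - K + 1.
Proof.
have k_le : (k <= k ^ 2)%N by rewrite -mulnn leq_pmulr // ltnW.
by rewrite /V /plane_size natrD natrB // natrX.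
Qed.

Let K_gt1 : 1 < K. Proof. by rewrite /K ltr1n. Qed.
Let K_neq0 : K != 0. Proof. by rewrite gt_eqF // (lt_trans ltr01). Qed.

Let I p b : R := (inc p b)%:R.

Let sumI_line p (F : B -> R) : \sum_(b | inc p b) F b = \sum_b I p b * F b.
Proof.
rewrite big_mkcond; apply: eq_bigr => b _; rewrite /I.
by case: (inc p b); rewrite ?mul1r ?mul0r.
Qed.

Let sumI_point b (F : P -> R) : \sum_(p | inc p b) F p = \sum_p I p b * F p.
Proof.
rewrite big_mkcond; apply: eq_bigr => p _; rewrite /I.
by case: (inc p b); rewrite ?mul1r ?mul0r.
Qed.

Let sum_points b : \sum_p I p b = K.
Proof.
under eq_bigr do rewrite -[I _ _]mulr1.
by rewrite -sumI_point sumr_const /K -(pp_line_size plane b) cardsE.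
Qed.

Let sum_lines p : \sum_b I p b = K.
Proof.
under eq_bigr do rewrite -[I _ _]mulr1.
by rewrite -sumI_line sumr_const /K -(pp_point_valency plane p) cardsE.
Qed.

Let gram p q : \sum_b I p b * I q b = if p == q then K else 1.
Proof.
case: eqVneq => [<-|pq].
  rewrite -(sum_lines p); apply: eq_bigr => b _.
  by rewrite /I -natrM mulnb andbb.
under eq_bigr do rewrite /I -natrM mulnb.
rewrite (natr_card R B predT) -[RHS]/(1%:R) -(pp_common_line plane pq).
by congr (_%:R); apply: eq_card => b; rewrite !inE.
Qed.

Let sum_gram p (x : P -> R) :
  \sum_q (\sum_b I p b * I q b) * x q = (K - 1) * x p + \sum_q x q.
Proof.
rewrite (bigD1 p) //= [\sum_q x q](bigD1 p) //= gram eqxx.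
rewrite (eq_bigr x); first by ring.
by move=> q qp; rewrite gram eq_sym (negPf qp) mul1r.
Qed.

Let valency_neq0 u : valency g u != 0%N.
Proof.
by case: u => [p|b]; rewrite ?valency_point ?valency_line; lia.
Qed.

(** An eigenfunction is split into [x] on points and [y] on lines; the sum over the other lines is
    the total minus the own value. *)
Let eigenP (a : R) : Leigenvalue R g a <->
  exists (x : P -> R) (y : B -> R),
    [/\ (exists p, x p != 0) \/ (exists b, y b != 0),
        forall p, \sum_b I p b * y b = (1 - a) * K * x p &
        forall b, \sum_p I p b * x p + (\sum_b' y b' - y b)
                  = (1 - a) * K ^+ 2 * y b].
Proof.
rewrite (LeigenvalueP _ _ _ join_lines_sym join_lines_irr valency_neq0).
have line_sum (y : B -> R) b : \sum_(b' | b' != b) y b' = \sum_b' y b' - y b.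
  by rewrite [in RHS](bigD1 b) //= [RHS]addrC addKr.
split=> [[z z_neq0 z_eig]|[x [y [xy_neq0 x_eq y_eq]]]].
  exists (z \o inl), (z \o inr); split.
  - by case: z_neq0 => -[p|b] ?; [left; exists p | right; exists b].
  - move=> p; have := z_eig (inl p).
    by rewrite sum_point valency_point sumI_line.
  move=> b; have := z_eig (inr b).
  by rewrite sum_line valency_line natrX sumI_point line_sum.
exists (fun u => match u with inl p => x p | inr b => y b end).
  by case: xy_neq0 => -[u u_neq0]; [exists (inl u) | exists (inr u)].
case=> [p|b]; first by rewrite sum_point valency_point sumI_line.
by rewrite sum_line valency_line natrX sumI_point line_sum.
Qed.

(** Eliminating [y] makes [kap * x p] independent of [p]. If [kap] is 0, its two factors give the
    two nontrivial values; otherwise [x] is constant, then so is [y], and one line equation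
    remains. *)
Let plane_Leigenvalue_cases (a : R) : Leigenvalue R g a ->
  [\/ a = 0, a = V / K ^+ 2 | a = 1 + 1 / K].
Proof.
move/eigenP => [x [y [xy_neq0 x_eq y_eq]]].
pose t := 1 - a; rewrite -/t in x_eq y_eq.
pose X := \sum_p x p; pose Y := \sum_b y b.
pose kap := (K * t + 1) * (K ^+ 2 * t - (K - 1)).
(* Summing the equations of the lines through p eliminates y. *)
have kap_x p : kap * x p = X + K * Y.
  have : \sum_b I p b * (\sum_q I q b * x q + (Y - y b))
         = \sum_b I p b * (t * K ^+ 2 * y b).
    by apply: eq_bigr => b _; rewrite y_eq.
  have -> : \sum_b I p b * (t * K ^+ 2 * y b) = t * K ^+ 2 * (t * K * x p).
    by rewrite -x_eq mulr_sumr; apply: eq_bigr => b _; ring.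
  have -> : \sum_b I p b * (\sum_q I q b * x q + (Y - y b)) =
      (K - 1) * x p + X + K * Y - t * K * x p.
    rewrite -x_eq -sum_gram -(sum_lines p) mulr_suml.
    under [\sum_q _ * x q]eq_bigr do rewrite mulr_suml.
    rewrite exchange_big -big_split -sumrB; apply: eq_bigr => b _ /=.
    rewrite mulrDr mulr_sumr mulrBr addrA; congr (_ + _ - _).
    by apply: eq_bigr => q _; rewrite mulrA.
  by move=> E; rewrite /kap; move: E; move: X Y (x p) => ? ? ?; lra.
have [kap0|kap_neq0] := eqVneq kap 0.
  move/eqP: kap0; rewrite mulf_eq0 => /orP[]/eqP E.
    apply: Or33; apply: (mulfI K_neq0); rewrite mulrDr mulrA mulr1 divff //.
    by move: E; rewrite /t; move: K => ?; lra.
  apply: Or32; apply: (mulfI (expf_neq0 2 K_neq0)).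
  rewrite mulrCA divff ?expf_neq0 // mulr1 V_eq.
  by move: E; rewrite /t; move: K => ?; lra.
pose x0 := (X + K * Y) / kap.
have x_cst p : x p = x0 by rewrite /x0 -(kap_x p) mulrC mulKf.
(* The incidence matrix sends [y] and the constant [t * x0] to the same vector, and it is injective
   by its Gram matrix [(K - 1) I + J]. *)
have y_cst b : y b = t * x0.
  apply/eqP; rewrite -subr_eq0; apply/eqP.
  have cardPB : #|[set: P]| = #|[set: B]|.
    by rewrite !cardsT (pp_card_points plane) (pp_card_lines plane).
  have := @gram_injective R P B setT setT I K 1 (fun b => y b - t * x0)
    cardPB ler01 K_gt1; apply; rewrite ?inE //.
    by move=> p q _ _; rewrite -gram; apply: eq_bigl => c; rewrite inE.
  move=> p _; transitivity (\sum_b I p b * y b - (\sum_b I p b) * (t * x0)).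
    rewrite mulr_suml -sumrB; apply: eq_big => c; rewrite ?inE //.
    by rewrite mulrBr.
  by rewrite x_eq sum_lines x_cst; ring.
have x0_neq0 : x0 != 0.
  case: xy_neq0 => -[u]; rewrite ?x_cst ?y_cst //.
  by rewrite mulf_eq0 negb_or => /andP[].
have [b _] : exists b : B, true.
  have : (0 < #|B|)%N by rewrite (pp_card_lines plane) /plane_size addn1.
  by case/card_gt0P=> b _; exists b.
have := y_eq b.
have -> : \sum_p I p b * x p = K * x0.
  by rewrite -(sum_points b) mulr_suml; apply: eq_bigr => p _; rewrite x_cst.
have -> : \sum_b y b = V * (t * x0).
  under eq_bigr do rewrite y_cst.
  by rewrite sumr_const (pp_card_lines plane) mulr_natl.
rewrite y_cst V_eq => E.
(* The line equation for constant [x] and [y], factored using [V - 1 = K ^+ 2 - K]. Its roots in [t]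
   give the values 0 and [1 + 1 / K] of [a]. *)
have : x0 * K * ((1 - t) * (1 + K * t)) = 0.
  by move: E; lra.
move/eqP; rewrite mulf_eq0 (negPf (mulf_neq0 x0_neq0 K_neq0)) mulf_eq0 /=.
case/orP=> /eqP t_eq.
  by apply: Or31; move: t_eq; rewrite /t; lra.
apply: Or33; apply: (mulfI K_neq0); rewrite mulrDr mulrA mulr1 divff //.
by move: t_eq; rewrite /t; move: K => ?; lra.
Qed.

Lemma plane_Leigenvalue (a : R) :
  Leigenvalue R g a <-> [\/ a = 0, a = V / K ^+ 2 | a = 1 + 1 / K].
Proof.
split; first exact: plane_Leigenvalue_cases.
have [p [q pq]] : exists p q : P, p != q.
  suff /card_gt1P[p [q [_ _ pq]]] : (1 < #|P|)%N by exists p, q.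
  rewrite (pp_card_points plane) /plane_size addn1 ltnS subn_gt0.
  by rewrite -{1}[k]expn1 ltn_exp2l.
have sumV (y : R) : \sum_(b : B) y = V * y.
  by rewrite sumr_const (pp_card_lines plane) mulr_natl.
move=> a_cases; apply/eigenP; case: a_cases => ->.
- exists (fun=> 1), (fun=> 1); split.
  + by left; exists p; rewrite oner_neq0.
  + by move=> r; rewrite -mulr_suml sum_lines; ring.
  + by move=> b; rewrite -mulr_suml sum_points sumV V_eq; ring.
(* The difference of two points, with the matching difference of incidence rows on lines. The point
   equation fixes the factor [1 / K], and the line values sum to 0 because both points have the same
   valency. *)
- pose x r : R := (r == p)%:R - (r == q)%:R.
  exists x, (fun b => (I p b - I q b) / K); split.
  + by left; exists p; rewrite /x eqxx (negPf pq) subr0 oner_neq0.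
  + move=> r.
    transitivity ((\sum_b I r b * I p b - \sum_b I r b * I q b) / K).
      by rewrite -sumrB mulr_suml; apply: eq_bigr => b _; ring.
    rewrite !gram /x V_eq.
    by case: (r == p); case: (r == q); rewrite ?mulr1n ?mulr0n; field.
  move=> b; have xI : \sum_r I r b * x r = I p b - I q b.
    rewrite /x; under eq_bigr do rewrite mulrBr.
    rewrite sumrB (bigD1 p) //= eqxx mulr1 big1 ?addr0; last first.
      by move=> r /negPf->; rewrite mulr0.
    rewrite (bigD1 q) //= eqxx mulr1 big1 ?addr0 // => r /negPf->.
    by rewrite mulr0.
  rewrite xI -mulr_suml sumrB !sum_lines V_eq; field.
  exact: K_neq0.
(* Constant on each side; for this eigenvalue the point equation reads [K * y = - x], which fixes
   the ratio. *)
exists (fun=> 1), (fun=> - 1 / K); split.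
- by left; exists p; rewrite oner_neq0.
- by move=> r; rewrite -mulr_suml sum_lines; field.
by move=> b; rewrite -mulr_suml sum_points sumV V_eq; field.
Qed.

(** Ensures that the list of three eigenvalues has no repetition and that 0 is the only trivial one
    in it. *)
Lemma plane_Leigenvalues_neq :
  [/\ V / K ^+ 2 != 0, 1 + 1 / K != 0 & V / K ^+ 2 != 1 + 1 / K].
Proof.
split.
- by rewrite mulf_neq0 ?invr_neq0 ?expf_neq0 // pnatr_eq0 /plane_size addn1.
- by rewrite gt_eqF // addr_gt0 ?divr_gt0 ?(lt_trans ltr01 K_gt1).
rewrite -(inj_eq (mulfI (expf_neq0 2 K_neq0))) mulrCA divff ?expf_neq0 //.
rewrite mulr1 V_eq lt_eqF // -subr_gt0.
have -> : K ^+ 2 * (1 + 1 / K) - (K ^+ 2 - K + 1) = 2 * K - 1 by field.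
by move: K_gt1 => ?; lra.
Qed.

End PlaneGraph.

(** * The valency partition and the characterization *)

(** [A] is the valency class of some [x]. Only one other valency occurs, so the complement of [A] is
    the class of any vertex [y] having it. *)
Lemma biregular_parts (T : finType) (e : rel T) (A : {set T}) :
  biregular e -> A \in valency_partition e ->
  exists d1 d2, [/\ d1 != d2,
    [/\ {in A, forall u, valency e u = d1} & exists u, u \in A],
    [/\ {in ~: A, forall u, valency e u = d2} & exists u, u \in ~: A] &
    ~: A \in valency_partition e].
Proof.
move=> e_bireg /imsetP[x _ A_def].
have inA u : (u \in A) = (valency e x == valency e u).
  by rewrite A_def !inE.
have [y yx only] : exists2 y, valency e x != valency e y &
    forall u, valency e u \in [:: valency e x; valency e y].
  move: e_bireg; rewrite /biregular; set s := undup _ => s_size.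
  have s_uniq : uniq s := undup_uniq _.
  have s_mem u : valency e u \in s by rewrite mem_undup codom_f.
  have s_codom d : d \in s -> exists u, d = valency e u.
    by rewrite mem_undup => /codomP.
  case: s s_size s_uniq s_mem s_codom => [|d [|d' [|]]] //= _.
  rewrite inE andbT => dd' s_mem s_codom.
  have [u Du] : exists u, d = valency e u by apply: s_codom; rewrite mem_head.
  have [u' Du'] : exists u, d' = valency e u.
    by apply: s_codom; rewrite !inE eqxx orbT.
  have := s_mem x; rewrite !inE => /orP[]/eqP Dx.
    by exists u'; rewrite -?Du' Dx.
  exists u; rewrite -?Du Dx 1?eq_sym // => w.
  by have := s_mem w; rewrite !inE orbC.
have inC u : (u \in ~: A) = (valency e y == valency e u).
  rewrite inE inA; have := only u; rewrite !inE => /orP[]/eqP->.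
    by rewrite eqxx eq_sym (negPf yx).
  by rewrite eqxx.
exists (valency e x), (valency e y); split=> //.
- by split; [move=> u; rewrite inA => /eqP | exists x; rewrite inA].
- by split; [move=> u; rewrite inC => /eqP | exists y; rewrite inC].
by apply/imsetP; exists y => //; apply/setP=> u; rewrite inC !inE.
Qed.

Lemma connected_valency_neq0 (T : finType) (e : rel T) (u w : T) :
  connected_graph e -> u != w -> valency e u != 0%N.
Proof.
move=> e_conn uw; have /connectP[[|v p] /=] := e_conn u w.
  by move=> _ wu; rewrite wu eqxx in uw.
case/andP=> euv _ _; rewrite -lt0n; apply/card_gt0P; exists v.
by rewrite inE.
Qed.

Theorem proposition3 (R : rcfType) (T : finType) (e : rel T)
    (e_sym : symmetric e) (e_irr : irreflexive e)
    (e_conn : connected_graph e) (e_nbip : ~ bipartite e)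
    (e_bireg : biregular e)
    (eq_parts : forall A B : {set T}, A \in valency_partition e ->
       B \in valency_partition e -> #|A| = #|B|)
    (empty_part : exists2 A : {set T}, A \in valency_partition e &
       forall x y : T, x \in A -> y \in A -> ~~ e x y) :
  (has_exactly (Leigenvalue R e) 3 <->
     exists (k : nat) (P B : finType) (inc : P -> B -> bool),
       projective_plane inc k /\
       graph_iso (join_lines (incidence_graph inc)) e)
  /\
  (forall (k : nat) (P B : finType) (inc : P -> B -> bool),
     projective_plane inc k ->
     graph_iso (join_lines (incidence_graph inc)) e ->
     forall a : R,
       (Leigenvalue R e a /\ a != 0) <->
       (a = (plane_size k)%:R / k%:R ^+ 2 \/ a = 1 + 1 / k%:R)).
Proof.
have [A A_part A_empty] := empty_part.
have [d1 [d2 [d12 [A_val [x xA]] [C_val [y yC]] C_part]]] :=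
  biregular_parts _ _ _ e_bireg A_part.
have cardAC := eq_parts _ _ A_part C_part.
(* Both parts are inhabited, so every vertex has another vertex to be connected to. *)
have e_val u : valency e u != 0%N.
  have [<-|ux] := eqVneq x u.
    apply: (connected_valency_neq0 T e x y) => //.
    by apply: contraTneq yC => <-; rewrite inE xA.
  by apply: (connected_valency_neq0 T e u x) => //; rewrite eq_sym.
(* Shared by the converse implication and by the formula for the nonzero eigenvalues. *)
have spectrum k (P B : finType) (inc : P -> B -> bool) :
    projective_plane inc k -> graph_iso (join_lines (incidence_graph inc)) e ->
    forall a : R, Leigenvalue R e a <->
      [\/ a = 0, a = (plane_size k)%:R / k%:R ^+ 2 | a = 1 + 1 / k%:R].
  move=> plane iso a.
  rewrite -(Leigenvalue_iso _ _ _ _ _ a e_sym e_irr e_val iso).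
  exact: plane_Leigenvalue.
split; last first.
  move=> k P B inc plane iso a; rewrite (spectrum k P B inc) //.
  have [t1_neq0 t2_neq0 _] := plane_Leigenvalues_neq P B inc k plane R.
  split=> [[[->|->|->]]|[]->]; rewrite ?eqxx //; [by left|by right| |].
    by split=> //; apply: Or32.
  by split=> //; apply: Or33.
split=> [/(three_Leigenvalues_walks R T e e_sym e_irr e_val e_conn)|].
  (* The line size is the valency in the empty part. *)
  case=> [a [b [c walks]]]; exists d1.
  have d1_gt0 : (0 < d1)%N by rewrite -(A_val x) // lt0n.
  have d2_gt0 : (0 < d2)%N by rewrite -(C_val y) // lt0n.
  have C_val' u : u \notin A -> valency e u = d2.
    by move=> uA; apply: C_val; rewrite inE.
  have A_empty' u v : u \in A -> v \in A -> e u v = false.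
    by move=> uA vA; apply/negbTE/A_empty.
  exact: (plane_of_walks R T e A d1 d2 a b c).
case=> [k [P [B [inc [plane iso]]]]].
have [t1_neq0 t2_neq0 t12] := plane_Leigenvalues_neq P B inc k plane R.
exists [:: 0; (plane_size k)%:R / k%:R ^+ 2; 1 + 1 / k%:R]; split=> //.
  by rewrite /= !inE negb_or ![0 == _]eq_sym t1_neq0 t2_neq0 t12.
move=> a; apply/idP/idP=> [/(spectrum k P B inc plane iso)|].
  by case=> ->; rewrite !inE eqxx ?orbT.
rewrite !inE => a_cases; apply/(spectrum k P B inc plane iso).
by case/or3P: a_cases => /eqP; [apply: Or31 | apply: Or32 | apply: Or33].
Qed.
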